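(* Let $K=\mathbb{F}_q$ be a finite field with $q\neq 2$, let $G$ be a connected graph with $n$ vertices, and let $Y\subset\mathbb{P}^{s}$ be the set associated with the edges of $G$ (defined in the context). Then: (i) $|Y|=(q-1)^{n-1}$ if $G$ is bipartite; (ii) $|Y|=(q-1)^{n}$ if $G$ is not bipartite and $q$ is even; (iii) $|Y|=\frac{(q-1)^n}{2}$ if $G$ is not bipartite and $q$ is odd.
   Context: Graphs are finite and simple. Let $G$ have vertex set $\{y_1,\ldots,y_n\}$ and edges $f_1,\ldots,f_s$ ($s\geq 1$), and let $v_i=e_j+e_k\in\{0,1\}^n$ be the characteristic vector of $f_i=\{y_j,y_k\}$. Put $K^*=K\setminus\{0\}$ and, for $x\in (K^* )^n$, $x^{v_i}=x_1^{v_{i1}}\cdots x_n^{v_{in}}$. Define $Y=\{[(x^{v_1},\ldots,x^{v_s},1)] : x\in (K^* )^n\}\subset\mathbb{P}^{s}$, the projective space over $K$. *)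

(* Defs.v *)
From HB Require Import structures.
From mathcomp Require Import all_boot all_order all_algebra.

Set Implicit Arguments.
Unset Strict Implicit.
Unset Printing Implicit Defensive.

Import GRing.Theory.
Local Open Scope ring_scope.

(* A simple graph on T is a symmetric irreflexive relation e. *)
Definition edges (T : finType) (e : rel T) : {set {set T}} :=
  [set [set p.1; p.2] | p : T * T & e p.1 p.2].

Definition connected (T : finType) (e : rel T) : Prop :=
  forall x y : T, connect e x y.

Definition bipartite (T : finType) (e : rel T) : Prop :=
  exists A : {set T}, forall x y : T, e x y -> (x \in A) != (y \in A).

Definition char_vector (n : nat) (A : {set 'I_n}) : 'rV[nat]_n :=
  \row_j (j \in A : nat).

Definition monomial (K : fieldType) (n : nat) (x : 'rV[K]_n) (v : 'rV[nat]_n) : K :=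
  \prod_(j < n) x 0 j ^+ v 0 j.

(* Points of projective space are the classes of nonzero vectors of K^(s+1)
   modulo multiplication by K^*, represented as sets of vectors. *)
Definition proj_point (K : finFieldType) (m : nat) (v : 'rV[K]_m) : {set 'rV[K]_m} :=
  [set c *: v | c : K & c != 0].

Definition proj_space (K : finFieldType) (s : nat) : {set {set 'rV[K]_(s + 1)}} :=
  [set proj_point v | v : 'rV[K]_(s + 1) & v != 0].

Definition param_vector (K : fieldType) (n s : nat) (f : 'I_s -> {set 'I_n})
    (x : 'rV[K]_n) : 'rV[K]_(s + 1) :=
  row_mx (\row_(i < s) monomial x (char_vector (f i))) (const_mx 1).

Definition param_set (K : finFieldType) (n s : nat) (f : 'I_s -> {set 'I_n}) :
    {set {set 'rV[K]_(s + 1)}} :=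
  [set proj_point (param_vector f x) | x : 'rV[K]_n & [forall j, x 0 j != 0]].

Lemma param_set_sub (K : finFieldType) (n s : nat) (f : 'I_s -> {set 'I_n}) :
  param_set K f \subset proj_space K s.
Proof.
apply/subsetP=> _ /imsetP[x _ ->]; apply: imset_f; rewrite inE.
apply/eqP=> /matrixP /(_ 0 (rshift s 0)) /eqP.
by rewrite row_mxEr !mxE oner_eq0.
Qed.

Lemma proj_point_eqP (K : finFieldType) (m : nat) (v w : 'rV[K]_m) :
  proj_point v = proj_point w <-> exists2 c : K, c != 0 & v = c *: w.
Proof.
split=> [eq_vw | [c c_neq0 ->]].
  have: v \in proj_point v.
    by apply/imsetP; exists 1; rewrite ?inE ?oner_eq0 ?scale1r.
  by rewrite eq_vw => /imsetP[c]; rewrite inE => c_neq0 ->; exists c.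
apply/setP=> u; apply/imsetP/imsetP=> -[d]; rewrite inE => d_neq0 ->.
  by exists (d * c); rewrite ?inE ?mulf_neq0 ?scalerA.
exists (d / c); first by rewrite inE mulf_neq0 ?invr_eq0.
by rewrite scalerA divfK.
Qed.

(* Main.v *)
(** Two points [x], [y] of the torus have the same image iff the ratio [z = y / x]
satisfies [z_j z_k = 1] on every edge.  As the graph is connected, such a [z] takes only
the values [t] and [1 / t], where [t] is its value at a base vertex.  If [t^2 != 1] the two
level sets form a bipartition; conversely a bipartition realises every [t].  Hence all
fibres of the parametrisation have [q - 1] elements in the bipartite case, and as many
elements as there are square roots of [1] in [K] otherwise. *)
Require Import Defs.
From mathcomp Require Import all_boot all_order all_algebra finfield.

Set Implicit Arguments.
Unset Strict Implicit.
Unset Printing Implicit Defensive.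

Import GRing.Theory.
Local Open Scope ring_scope.

(** Reduces each case of the theorem to the size of one fibre. *)
Lemma card_imset_uniform_fibers (aT rT : finType) (g : aT -> rT) (A : {set aT}) (k : nat) :
  (forall x, x \in A -> #|[set y in A | g y == g x]| = k) ->
  #|A| = (#|g @: A| * k)%N.
Proof.
move=> fibk; rewrite -sum1_card (partition_big_imset g) /=.
rewrite -sum_nat_const; apply: eq_bigr => _ /imsetP[x Ax ->].
by rewrite -(fibk x Ax) -sum1dep_card.
Qed.

Section FiniteField.

Variable K : finFieldType.

Lemma card_nonzero : #|[set t : K | t != 0]| = #|K|.-1.
Proof.
by rewrite -(cardC1 (0 : K)); apply: eq_card => t; rewrite !inE.
Qed.

Lemma card_nonzero_rV (n : nat) :
  #|[set x : 'rV[K]_n | [forall j, x 0 j != 0]]| = (#|K|.-1 ^ n)%N.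
Proof.
pose row_of (g : {ffun 'I_n -> K}) : 'rV[K]_n := \row_j g j.
have row_inj : injective row_of.
  by move=> g h /rowP gh; apply/ffunP => j; have := gh j; rewrite !mxE.
rewrite -card_nonzero -[n in RHS]card_ord -card_ffun_on -(card_imset _ row_inj).
apply: eq_card => x; rewrite inE; apply/forallP/imsetP => [x0 | [g /ffun_onP g0 ->] j].
  exists [ffun j => x 0 j]; last by apply/rowP => j; rewrite mxE ffunE.
  by apply/ffun_onP => j; rewrite ffunE inE.
by have := g0 j; rewrite mxE inE.
Qed.

(** If [1 = -1] the characteristic is 2, so [#|K|] is a power of 2, with nonzero exponent as
    [#|K| > 1]. Conversely, for even [#|K|], raising [-1] to the power [#|K|] gives [1], yet it must
    fix [-1]. *)
Lemma eq_oppr1_even : (1 == -1 :> K) = ~~ odd #|K|.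
Proof.
apply/idP/idP => [/eqP one_opp | evenK].
  have char2 : 2%N \in [pchar K].
    by rewrite inE /= mulr2n {2}one_opp subrr eqxx.
  have := finNzRing_gt1 K; rewrite (card_pprimeChar char2) oddX orbF.
  by case: logn.
by rewrite -{1}(expf_card (-1 : K)) -signr_odd (negbTE evenK).
Qed.

Lemma card_sqrt1 : #|[set t : K | t ^+ 2 == 1]| = (odd #|K|).+1.
Proof.
have -> : [set t : K | t ^+ 2 == 1] = [set 1; -1].
  by apply/setP => t; rewrite !inE sqrf_eq1.
by rewrite cards2 eq_oppr1_even negbK.
Qed.

End FiniteField.

Lemma monomial_char_vector2 (K : fieldType) (n : nat) (x : 'rV[K]_n) (j k : 'I_n) :
  j != k -> monomial x (char_vector [set j; k]) = x 0 j * x 0 k.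
Proof.
move=> jk; rewrite /monomial.
transitivity (\prod_(i in [set j; k]) x 0 i).
  rewrite [RHS]big_mkcond /=; apply: eq_bigr => i _.
  by rewrite mxE; case: ifP => _; rewrite ?expr1 ?expr0.
by rewrite big_setU1 ?big_set1 ?inE.
Qed.

(* The last coordinate is 1, so the scalar relating two representatives is 1. *)
Lemma eq_proj_param (K : finFieldType) (n s : nat) (f : 'I_s -> {set 'I_n})
    (x y : 'rV[K]_n) :
  proj_point (param_vector f x) = proj_point (param_vector f y) <->
  forall i, monomial x (char_vector (f i)) = monomial y (char_vector (f i)).
Proof.
split=> [/proj_point_eqP[c _ /rowP xy] i | xy].
  have := xy (rshift s 0); rewrite [RHS]mxE !row_mxEr !mxE mulr1 => c1.
  by have := xy (lshift 1 i); rewrite [RHS]mxE !row_mxEl !mxE -c1 mul1r.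
congr (proj_point (row_mx _ _)).
by apply/rowP => i; rewrite !mxE.
Qed.

Lemma connected_ind (T : finType) (e : rel T) (P : T -> Prop) (r : T) :
  connected e -> P r -> (forall x y, e x y -> P x -> P y) -> forall x, P x.
Proof.
move=> e_conn Pr step x; have /connectP[p ep ->] := e_conn r x.
elim: p r Pr ep => //= y p IH r Pr /andP[/step ry]; exact: IH (ry Pr).
Qed.

Section Fibers.

Variables (K : finFieldType) (n : nat) (e : rel 'I_n).
Hypothesis e_irr : irreflexive e.
Hypothesis e_conn : connected e.
Variables (s : nat) (f : 'I_s -> {set 'I_n}).
Hypothesis f_edges : [set f i | i : 'I_s] = edges e.

Let torus := [set x : 'rV[K]_n | [forall j, x 0 j != 0]].

(** Irreflexivity makes every edge a set of two distinct vertices, so its monomial is the product of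
    two coordinates. *)
Lemma eq_proj_param_edge (x y : 'rV[K]_n) :
  proj_point (param_vector f x) = proj_point (param_vector f y) <->
  forall j k, e j k -> x 0 j * x 0 k = y 0 j * y 0 k.
Proof.
have neq j k : e j k -> j != k by apply: contraTneq => ->; rewrite e_irr.
split=> [/eq_proj_param xy j k ejk | xy].
  have : [set j; k] \in edges e by apply/imsetP; exists (j, k); rewrite ?inE.
  rewrite -f_edges => /imsetP[i _ fi].
  by rewrite -!monomial_char_vector2 ?neq // fi.
apply/eq_proj_param => i.
have : f i \in edges e by rewrite -f_edges imset_f.
case/imsetP=> -[j k]; rewrite inE /= => ejk ->.
by rewrite !monomial_char_vector2 ?xy ?neq.
Qed.

(** Crossing an edge inverts the value of [z], and inversion swaps the two candidates. *)
Lemma edge_inv_values (z : 'I_n -> K) (r : 'I_n) :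
  (forall j k, e j k -> z j * z k = 1) -> z r != 0 ->
  forall j, z j = z r \/ z j = (z r)^-1.
Proof.
move=> zz zr0; apply: (@connected_ind _ _ _ r e_conn); first by left.
move=> j k /zz zjk [] zj; rewrite zj in zjk; [right | left].
  by rewrite -[z k](mulKf zr0) zjk mulr1.
by rewrite -[z k](mulVKf zr0) zjk mulr1.
Qed.

Lemma edge_inv_bipartite (z : 'I_n -> K) (r : 'I_n) :
  (forall j k, e j k -> z j * z k = 1) -> z r ^+ 2 != 1 -> bipartite e.
Proof.
move=> zz zr1; have [zr0|zr0] := eqVneq (z r) 0.
  (* A zero value at [j] rules out any edge at [j], since [0 = 1] would follow. The graph then has
     no edge, and any set is a bipartition. *)
  have z0 : forall j, z j = 0.
    apply: (@connected_ind _ _ _ r e_conn) => // j k /zz /eqP zjk zj.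
    by rewrite zj mul0r eq_sym oner_eq0 in zjk.
  exists set0 => j k /zz; rewrite z0 mul0r => /esym/eqP.
  by rewrite oner_eq0.
have neq : (z r)^-1 != z r.
  by apply: contraNneq zr1 => zrV; rewrite expr2 -{1}zrV mulVf.
(* An edge inside one level set would make [z r ^+ 2] or its inverse equal to 1. *)
exists [set j | z j == z r] => j k /zz; rewrite !inE.
have [-> | ->] := edge_inv_values zz zr0 j;
  have [-> | ->] := edge_inv_values zz zr0 k; rewrite ?eqxx ?(negbTE neq) //.
  by move/eqP; rewrite -expr2 (negbTE zr1).
by move/eqP; rewrite -invfM -expr2 invr_eq1 (negbTE zr1).
Qed.

Lemma ratio_edge (x y : 'rV[K]_n) :
  x \in torus -> proj_point (param_vector f y) = proj_point (param_vector f x) ->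
  forall j k, e j k -> (y 0 j / x 0 j) * (y 0 k / x 0 k) = 1.
Proof.
rewrite inE => /forallP x0 /eq_proj_param_edge yx j k ejk.
by rewrite mulrACA -invfM yx // divff // mulf_neq0.
Qed.

(** The fibre through [x] is the set of twists of [x] by nonzero [t]: multiply by [t] on the side of
    [r] and by [t^-1] on the other. The coordinate at [r] recovers [t]. *)
Lemma card_param_bipartite (r : 'I_n) :
  bipartite e -> (#|param_set K f| * #|K|.-1)%N = (#|K|.-1 ^ n)%N.
Proof.
case=> A biA; rewrite -card_nonzero_rV; apply/esym.
apply: card_imset_uniform_fibers => x Tx.
have x0 j : x 0 j != 0 by move: Tx; rewrite inE => /forallP.
pose sgn (t : K) j := if (j \in A) == (r \in A) then t else t^-1.
pose tw t : 'rV[K]_n := \row_j (sgn t j * x 0 j).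
have tw_inj : injective tw.
  move=> t u /rowP/(_ r); rewrite !mxE /sgn eqxx; exact: mulIf.
rewrite -(card_nonzero K) -(card_imset _ tw_inj); apply: eq_card => y.
rewrite !inE; apply/andP/imsetP => [[/forallP y0 /eqP yx] | [t]].
  have zz := ratio_edge Tx yx; pose z j := y 0 j / x 0 j.
  have zr0 : z r != 0 by rewrite mulf_neq0 ?invr_eq0.
  exists (z r); first by rewrite inE.
  suffices sgnz j : z j = sgn (z r) j by apply/rowP => j; rewrite mxE -sgnz divfK.
  (* Each edge changes side and inverts [z], just as [sgn] does. *)
  move: j; apply: (@connected_ind _ _ _ r e_conn); first by rewrite /sgn eqxx.
  move=> j k ejk zj; have zj0 : z j != 0 by rewrite mulf_neq0 ?invr_eq0.
  have -> : z k = (z j)^-1 by rewrite -[z k](mulKf zj0) zz ?mulr1.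
  rewrite zj /sgn; have := biA _ _ ejk.
  by case: (j \in A); case: (k \in A); case: (r \in A); rewrite //= invrK.
rewrite inE => t0 ->; have sgn0 j : sgn t j != 0 by rewrite /sgn; case: ifP; rewrite ?invr_eq0.
split; first by apply/forallP => j; rewrite mxE mulf_neq0.
apply/eqP/eq_proj_param_edge => j k ejk; rewrite !mxE mulrACA.
have := biA _ _ ejk; rewrite /sgn.
by case: (j \in A); case: (k \in A); case: (r \in A); rewrite //= ?mulfV ?mulVf ?mul1r.
Qed.

(** Without a bipartition [z r] squares to 1, so it is its own inverse and the ratio is constant.
    The fibre through [x] is thus the set of [t *: x] with [t ^+ 2 = 1]. *)
Lemma card_param_nonbipartite (r : 'I_n) :
  ~ bipartite e -> (#|param_set K f| * (odd #|K|).+1)%N = (#|K|.-1 ^ n)%N.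
Proof.
move=> nbi; rewrite -card_nonzero_rV; apply/esym.
apply: card_imset_uniform_fibers => x Tx.
have x0 j : x 0 j != 0 by move: Tx; rewrite inE => /forallP.
have sc_inj : injective (fun t : K => t *: x).
  move=> t u /rowP/(_ r); rewrite !mxE; exact: mulIf.
rewrite -card_sqrt1 -(card_imset _ sc_inj); apply: eq_card => y.
rewrite !inE; apply/andP/imsetP => [[/forallP y0 /eqP yx] | [t]].
  have zz := ratio_edge Tx yx; pose z j := y 0 j / x 0 j.
  have zr0 : z r != 0 by rewrite mulf_neq0 ?invr_eq0.
  have zr1 : z r ^+ 2 == 1.
    by apply/negP => /negP zr1; apply: nbi; apply: edge_inv_bipartite zz zr1.
  have zrV : (z r)^-1 = z r by rewrite -[LHS]mulr1 -(eqP zr1) mulKf.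
  exists (z r); first by rewrite inE.
  suffices zc j : z j = z r by apply/rowP => j; rewrite mxE -(zc j) divfK.
  by have [|] := edge_inv_values zz zr0 j; rewrite ?zrV.
rewrite inE => /eqP t1 ->.
have t0 : t != 0 by apply: contra_eqN t1 => /eqP ->; rewrite expr0n eq_sym oner_eq0.
split; first by apply/forallP => j; rewrite mxE mulf_neq0.
by apply/eqP/eq_proj_param_edge => j k ejk; rewrite !mxE mulrACA -expr2 t1 mul1r.
Qed.

End Fibers.

Theorem corollary2p9 (K : finFieldType) (q : nat) (hq : #|K| = q) (hq2 : q <> 2%N)
    (n : nat) (e : rel 'I_n) (e_sym : symmetric e) (e_irr : irreflexive e)
    (e_conn : connected e)
    (s : nat) (s_ge1 : (1 <= s)%N) (f : 'I_s -> {set 'I_n})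
    (f_inj : injective f) (f_edges : [set f i | i : 'I_s] = edges e) :
  [/\ bipartite e -> #|param_set K f| = ((q - 1) ^ (n - 1))%N,
      ~ bipartite e -> ~~ odd q -> #|param_set K f| = ((q - 1) ^ n)%N
    & ~ bipartite e -> odd q ->
        #|param_set K f|%:R = ((q - 1) ^ n)%:R / 2%:R :> rat].
Proof.
(* As [s >= 1] there is an edge; one of its ends serves as base vertex [r]. *)
have : f (Ordinal s_ge1) \in edges e by rewrite -f_edges imset_f.
case/imsetP=> -[r _] _ _.
subst q; rewrite !subn1; split=> [bi | nbi evenK | nbi oddK].
(* One factor [q - 1] is cancelled; [n > 0] ensures that the truncated [n.-1] has successor [n]. *)
- have K1 : (0 < #|K|.-1)%N by rewrite -subn1 subn_gt0 finNzRing_gt1.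
  have n0 : (0 < n)%N by apply: leq_ltn_trans (ltn_ord r).
  apply/eqP; rewrite -(eqn_pmul2r K1) -expnSr prednK //.
  by rewrite (card_param_bipartite K e_irr e_conn f_edges r bi).
- have := card_param_nonbipartite K e_irr e_conn f_edges r nbi.
  by rewrite (negbTE evenK) muln1.
have <- := card_param_nonbipartite K e_irr e_conn f_edges r nbi.
by rewrite oddK natrM mulfK.
Qed.
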